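(* The function $\theta_\star$ of a subextremal Kerr--Newman--de Sitter black hole interior is continuous at $\theta=0$ and at $\theta=\frac\pi2$, and there is a constant $C>0$ depending only on $\Lambda,M,a,e$ such that for all $r\in[r_-,r_+]$ and $\theta\in(0,\frac\pi2)$, with $\theta_\star=\theta_\star(r,\theta)$, $$\frac{\sin\theta_\star}{\sin\theta}+\frac{\cos\theta}{\cos\theta_\star}\le C .$$
   Context: Parameters: $\Lambda>0$, $M>0$, $a>0$, $e\in\mathbb R$; $\Delta_r=(r^2+a^2)(1-\frac{\Lambda}{3}r^2)-2Mr+e^2$, $\Delta_\theta=1+\frac{\Lambda}{3}a^2\cos^2\theta$. Subextremality (assumed): $\Delta_r$ has four distinct real roots $r_n<0<r_-<r_+<r_c$; hence $\Delta_r<0$ on $(r_-,r_+)$. Set $P(\theta,\theta_\star)=a\sqrt{\sin^2\theta_\star\Delta_\theta-\sin^2\theta}$ and $Q(r,\theta_\star)=\sqrt{(r^2+a^2)^2-a^2\sin^2\theta_\star\Delta_r}$. For $r\in[r_-,r_+]$ and $\theta\in(0,\frac\pi2)$, $\theta_\star=\theta_\star(r,\theta)\in[\theta,\frac\pi2)$ is the unique solution of $$F(r,\theta,\theta_\star):=\int_{\theta_\star}^{\theta}\frac{d\theta'}{P(\theta',\theta_\star)}+\int_r^{r_+}\frac{dr'}{Q(r',\theta_\star)}=0;$$ also $\theta_\star(r,0)=0$, $\theta_\star(r,\frac\pi2)=\frac\pi2$, and $\theta_\star(r,\theta)=\pi-\theta_\star(r,\pi-\theta)$ for $\theta\in(\frac\pi2,\pi]$.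 *)

(* Defs.v *)
From Stdlib Require Import Reals.
From Coquelicot Require Import Coquelicot.

Local Open Scope R_scope.

Definition Delta_r (Lambda M a e r : R) : R :=
  (r ^ 2 + a ^ 2) * (1 - Lambda / 3 * r ^ 2) - 2 * M * r + e ^ 2.

Definition Delta_theta (Lambda a theta : R) : R :=
  1 + Lambda / 3 * a ^ 2 * cos theta ^ 2.

(* [Delta_r] is a quartic in [r] with leading coefficient [- Lambda / 3], so
   for [Lambda > 0] four distinct zeros are all of its roots, and their
   ordering determines [rn], [rm], [rp], [rc] from the parameters. *)
Definition subextremal (Lambda M a e rn rm rp rc : R) : Prop :=
  (Delta_r Lambda M a e rn = 0 /\ Delta_r Lambda M a e rm = 0 /\
   Delta_r Lambda M a e rp = 0 /\ Delta_r Lambda M a e rc = 0) /\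
  (rn < 0 /\ 0 < rm /\ rm < rp /\ rp < rc).

Definition Pfun (Lambda a theta ts : R) : R :=
  a * sqrt (sin ts ^ 2 * Delta_theta Lambda a theta - sin theta ^ 2).

Definition Qfun (Lambda M a e r ts : R) : R :=
  sqrt ((r ^ 2 + a ^ 2) ^ 2 - a ^ 2 * sin ts ^ 2 * Delta_r Lambda M a e r).

(* For [0 < theta <= ts < PI / 2] and [rm <= r <= rp] both integrands are
   continuous on the closed intervals of integration, so these are proper
   Riemann integrals; the first one is oriented from [ts] to [theta]. *)
Definition Ffun (Lambda M a e rp r theta ts : R) : R :=
  RInt (fun th' => / Pfun Lambda a th' ts) ts theta +
  RInt (fun r' => / Qfun Lambda M a e r' ts) r rp.

(* [thstar] is unconstrained outside [rm, rp] x [0, PI]. *)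
Definition is_theta_star (Lambda M a e rm rp : R) (thstar : R -> R -> R)
  : Prop :=
  forall r : R, rm <= r <= rp ->
    (forall theta : R, 0 < theta < PI / 2 ->
       unique (fun ts : R => theta <= ts < PI / 2 /\
                             Ffun Lambda M a e rp r theta ts = 0)
              (thstar r theta)) /\
    thstar r 0 = 0 /\
    thstar r (PI / 2) = PI / 2 /\
    (forall theta : R, PI / 2 < theta <= PI ->
       thstar r theta = PI - thstar r (PI - theta)).

Definition theta_star_domain (rm rp : R) (p : R * R) : Prop :=
  rm <= fst p <= rp /\ 0 <= snd p <= PI.

(* Joint continuity in [(r, theta)], relative to the domain. *)
Definition theta_star_continuous_at (rm rp : R) (thstar : R -> R -> R)
  (r theta : R) : Prop :=
  filterlim (fun p : R * R => thstar (fst p) (snd p))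
            (within (theta_star_domain rm rp) (locally (r, theta)))
            (locally (thstar r theta)).

(* Main.v *)
Require Import Defs.
From Stdlib Require Import Reals Lra Psatz.
From Coquelicot Require Import Coquelicot.

Local Open Scope R_scope.

(** Put [k = Lambda a^2 / 3] and [x = sin theta_star]. The defining equation
    equates the [theta]-integral of [1 / P] with the [r]-integral of [1 / Q].
    Since [Delta_r <= 0] between the horizons, [Q >= r^2 + a^2], so [a] times the
    latter is at most [atan (rp / a) - atan (rm / a)].

    The ratio of cosines is controlled because [P <= a sqrt (1 + k) cos theta'],
    which makes the [theta]-integral at least logarithmic in that ratio.

    The ratio of sines is more delicate: as [theta -> 0] the [theta]-integral stays
    bounded, so constants have to be compared. From
    [P <= a sqrt (x^2 (1 + k) - sin^2 theta')], [a] times the [theta]-integral is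
    at least [atan (1 / sqrt k) - atan y], with
    [y = sin theta / sqrt (x^2 (1 + k) - sin^2 theta)]. Vieta's formulas give
    [Lambda rp^2 / 3 < 1], that is [rp / a < 1 / sqrt k], whence [y >= rm / a],
    and this bounds [x / sin theta]. *)

(** * Comparison of integrals with explicit antiderivatives *)

Lemma RInt_ge_increment (f g G : R -> R) (a b : R) :
  a <= b ->
  (forall x, a <= x <= b -> is_derive G x (g x)) ->
  (forall x, a <= x <= b -> continuous g x) ->
  (forall x, a <= x <= b -> continuous f x) ->
  (forall x, a <= x <= b -> g x <= f x) ->
  G b - G a <= RInt f a b.
Proof.
intros hab hG hg hf hle.
assert (I : is_RInt g a b (G b - G a)).
{ apply (is_RInt_derive G g); rewrite Rmin_left, Rmax_right; assumption. }
rewrite <- (is_RInt_unique _ _ _ _ I).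
apply RInt_le; [assumption | now exists (G b - G a) | | ].
- apply (@ex_RInt_continuous R_CompleteNormedModule).
  now rewrite Rmin_left, Rmax_right.
- intros x hx; apply hle; lra.
Qed.

Lemma RInt_le_increment (f g G : R -> R) (a b : R) :
  a <= b ->
  (forall x, a <= x <= b -> is_derive G x (g x)) ->
  (forall x, a <= x <= b -> continuous g x) ->
  (forall x, a <= x <= b -> continuous f x) ->
  (forall x, a <= x <= b -> f x <= g x) ->
  RInt f a b <= G b - G a.
Proof.
intros hab hG hg hf hle.
assert (I : is_RInt g a b (G b - G a)).
{ apply (is_RInt_derive G g); rewrite Rmin_left, Rmax_right; assumption. }
rewrite <- (is_RInt_unique _ _ _ _ I).
apply RInt_le; [assumption | | now exists (G b - G a) | ].
- apply (@ex_RInt_continuous R_CompleteNormedModule).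
  now rewrite Rmin_left, Rmax_right.
- intros x hx; apply hle; lra.
Qed.

Lemma Rmult_eq_0_cancel_l (x y : R) : x <> 0 -> x * y = 0 -> y = 0.
Proof. intros hx h; destruct (Rmult_integral _ _ h); tauto. Qed.

Lemma atan_le (x y : R) : x <= y -> atan x <= atan y.
Proof.
intros [h | ->]; [left; now apply atan_increasing | lra].
Qed.

Lemma atan_le_inv (x y : R) : atan x <= atan y -> x <= y.
Proof.
intros h; destruct (Rle_or_lt x y) as [| hlt]; [assumption |].
apply atan_increasing in hlt; lra.
Qed.

(** * Roots of [Delta_r] and its sign between the horizons *)

Section BlackHole.

Variables (Lambda M a e rn rm rp rc : R).
Hypotheses (hLambda : 0 < Lambda) (ha : 0 < a)
  (hsub : subextremal Lambda M a e rn rm rp rc).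

(* The second divided difference of [Delta_r] at three of its roots. *)
Lemma Delta_r_root_triple (x y z : R) :
  Delta_r Lambda M a e x = 0 -> Delta_r Lambda M a e y = 0 ->
  Delta_r Lambda M a e z = 0 -> x <> y -> x <> z -> y <> z ->
  1 - Lambda / 3 * a ^ 2
    = Lambda / 3 * (x ^ 2 + y ^ 2 + z ^ 2 + x * y + y * z + x * z).
Proof.
unfold Delta_r; intros hx hy hz hxy hxz hyz.
(* The first divided difference of [Delta_r]; differencing it once more gives the claim. *)
assert (D : forall u v,
  (u ^ 2 + a ^ 2) * (1 - Lambda / 3 * u ^ 2) - 2 * M * u + e ^ 2 = 0 ->
  (v ^ 2 + a ^ 2) * (1 - Lambda / 3 * v ^ 2) - 2 * M * v + e ^ 2 = 0 ->
  u <> v ->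
  (1 - Lambda / 3 * a ^ 2) * (u + v) - 2 * M
    - Lambda / 3 * (u + v) * (u ^ 2 + v ^ 2) = 0).
{ intros u v hu hv huv; apply (Rmult_eq_0_cancel_l (u - v)); [lra |].
  rewrite <- (Rminus_diag_eq _ _ (eq_trans hu (eq_sym hv))); ring. }
pose proof (D x y hx hy hxy) as h1; pose proof (D x z hx hz hxz) as h2.
apply Rminus_diag_uniq, (Rmult_eq_0_cancel_l (y - z)); [lra |].
rewrite <- (Rminus_diag_eq _ _ (eq_trans h1 (eq_sym h2))); ring.
Qed.

(** In the identity for the three positive roots, [rp ^ 2] is one of six positive terms on the
    right, and the left side is below 1. *)
Lemma rp_lt_cosmological_radius : Lambda / 3 * rp ^ 2 < 1.
Proof.
destruct hsub as [[_ [h2 [h3 h4]]] [_ [h5 [h6 h7]]]].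
pose proof (Delta_r_root_triple rm rp rc h2 h3 h4
  ltac:(lra) ltac:(lra) ltac:(lra)) as h.
assert (0 < Lambda / 3 * a ^ 2) by (apply Rmult_lt_0_compat; nra).
assert (0 < Lambda / 3 * (rm ^ 2 + rc ^ 2 + rm * rp + rp * rc + rm * rc))
  by (apply Rmult_lt_0_compat; nra).
nra.
Qed.

Lemma Delta_r_factor (r : R) :
  Delta_r Lambda M a e r
    = - (Lambda / 3) * ((r - rm) * (r - rp) * (r - rc) * (r - rn)).
Proof.
destruct hsub as [[h1 [h2 [h3 h4]]] [h0 [h5 [h6 h7]]]].
pose proof (Delta_r_root_triple rm rp rc h2 h3 h4
  ltac:(lra) ltac:(lra) ltac:(lra)) as t1.
pose proof (Delta_r_root_triple rm rp rn h2 h3 h1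
  ltac:(lra) ltac:(lra) ltac:(lra)) as t2.
(* The quartic has no cubic term: [t1] and [t2] differ by [Lambda / 3 * (rc - rn)] times the sum of
   the four roots. *)
assert (hn : rn = - (rm + rp + rc)).
{ apply Rminus_diag_uniq.
  apply (Rmult_eq_0_cancel_l (Lambda / 3 * (rc - rn))); [nra |].
  rewrite t1 in t2; apply Rminus_diag_eq in t2; lra. }
unfold Delta_r in *; rewrite hn.
assert (E : e ^ 2 = - ((rm ^ 2 + a ^ 2) * (1 - Lambda / 3 * rm ^ 2) - 2 * M * rm))
  by lra.
(* First divided difference at [rm] and [rp]. *)
assert (m : 2 * M = (1 - Lambda / 3 * a ^ 2) * (rm + rp)
   - Lambda / 3 * (rm + rp) * (rm ^ 2 + rp ^ 2)).
{ apply Rminus_diag_uniq, (Rmult_eq_0_cancel_l (rp - rm)); [lra |].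
  rewrite <- (Rminus_diag_eq _ _ (eq_trans h2 (eq_sym h3))); ring. }
rewrite E, m.
(* Isolates the quadratic coefficient, which [t1] expresses through the roots. *)
replace ((r ^ 2 + a ^ 2) * (1 - Lambda / 3 * r ^ 2))
  with (r ^ 2 * (1 - Lambda / 3 * a ^ 2) + a ^ 2 - Lambda / 3 * r ^ 4) by ring.
replace ((rm ^ 2 + a ^ 2) * (1 - Lambda / 3 * rm ^ 2))
  with (rm ^ 2 * (1 - Lambda / 3 * a ^ 2) + a ^ 2 - Lambda / 3 * rm ^ 4) by ring.
rewrite t1; ring.
Qed.

Lemma Delta_r_nonpos (r : R) : rm <= r <= rp -> Delta_r Lambda M a e r <= 0.
Proof.
intros hr; rewrite Delta_r_factor; destruct hsub as [_ [h0 [h5 [h6 h7]]]].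
assert (0 <= (r - rm) * (rp - r)) by (apply Rmult_le_pos; lra).
assert (0 <= (rc - r) * (r - rn)) by (apply Rmult_le_pos; lra).
assert (0 <= (r - rm) * (rp - r) * ((rc - r) * (r - rn)))
  by (apply Rmult_le_pos; assumption).
nra.
Qed.

(** * Upper bound for the [r]-integral *)

Lemma RInt_inv_Qfun_le (r ts : R) : rm <= r <= rp ->
  a * RInt (fun r' => / Qfun Lambda M a e r' ts) r rp
    <= atan (rp / a) - atan (rm / a).
Proof.
intros hr.
assert (hq : forall x, r <= x <= rp -> (x ^ 2 + a ^ 2) ^ 2 <=
  (x ^ 2 + a ^ 2) ^ 2 - a ^ 2 * sin ts ^ 2 * Delta_r Lambda M a e x).
{ intros x hx; pose proof (Delta_r_nonpos x ltac:(lra)).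
  assert (0 <= a ^ 2 * sin ts ^ 2) by (apply Rmult_le_pos; apply pow2_ge_0).
  nra. }
assert (h : RInt (fun r' => / Qfun Lambda M a e r' ts) r rp
            <= / a * atan (rp / a) - / a * atan (r / a)).
{ apply (RInt_le_increment _ (fun x => / (x ^ 2 + a ^ 2))
           (fun x => / a * atan (x / a))); [lra | | | |].
  - intros x _; auto_derive; [lra |]; field; nra.
  - intros x _; apply (@ex_derive_continuous R_AbsRing R_NormedModule).
    auto_derive; nra.
  - intros x hx; specialize (hq x hx).
    apply (@ex_derive_continuous R_AbsRing R_NormedModule).
    unfold Qfun, Delta_r in *; auto_derive.
    assert (0 < (x ^ 2 + a ^ 2) ^ 2) by (apply pow_lt; nra).
    repeat split; [lra |]; apply Rgt_not_eq, sqrt_lt_R0; lra.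
  - intros x hx; apply Rinv_le_contravar; [nra |].
    unfold Qfun; rewrite <- (sqrt_pow2 (x ^ 2 + a ^ 2)) at 1 by nra.
    apply sqrt_le_1_alt; auto. }
(* Lowering the endpoint to [rm] makes the bound uniform in [r]. *)
assert (hrm : atan (rm / a) <= atan (r / a)).
{ apply atan_le, Rmult_le_compat_r; [left; now apply Rinv_0_lt_compat | lra]. }
apply (Rmult_le_compat_l a) in h; [| lra].
rewrite <- Rmult_minus_distr_l, <- Rmult_assoc, Rinv_r in h; lra.
Qed.

(** * The radicand of [P] and the [theta]-integral *)

Let k := Lambda / 3 * a ^ 2.

Lemma k_pos : 0 < k.
Proof. apply Rmult_lt_0_compat; nra. Qed.

Lemma Pfun_radicand_sin (th ts : R) :
  sin ts ^ 2 * Delta_theta Lambda a th - sin th ^ 2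
    = sin ts ^ 2 * (1 + k) - (1 + k * sin ts ^ 2) * sin th ^ 2.
Proof.
unfold Delta_theta, k.
replace (cos th ^ 2) with (1 - sin th ^ 2); [ring |].
rewrite <- !Rsqr_pow2, cos2; ring.
Qed.

Lemma sin_sq_le (th ts : R) : 0 <= th <= ts -> ts < PI / 2 ->
  0 <= sin th <= sin ts /\ sin th ^ 2 <= sin ts ^ 2.
Proof.
intros h1 h2; pose proof PI_RGT_0.
assert (0 <= sin th) by (apply sin_ge_0; lra).
assert (sin th <= sin ts) by (apply sin_incr_1; lra).
split; [lra |]; apply pow_incr; lra.
Qed.

(** The radicand decreases in [sin th ^ 2]; at [th = ts], with [x = sin ts], it equals
    [k * x ^ 2 * (1 - x ^ 2)]. *)
Lemma Pfun_radicand_pos (th ts : R) : 0 < th <= ts -> ts < PI / 2 ->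
  0 < sin ts ^ 2 * Delta_theta Lambda a th - sin th ^ 2.
Proof.
intros h1 h2; rewrite Pfun_radicand_sin.
destruct (sin_sq_le th ts) as [h3 h4]; [lra | lra |].
assert (h5 : 0 < sin ts) by (apply sin_gt_0; lra).
assert (h6 : sin ts < 1).
{ rewrite <- sin_PI2; apply sin_increasing_1; lra. }
pose proof k_pos.
assert (0 < sin ts ^ 2 < 1) by (split; nra).
assert ((1 + k * sin ts ^ 2) * sin th ^ 2 <= (1 + k * sin ts ^ 2) * sin ts ^ 2)
  by (apply Rmult_le_compat_l; nra).
assert (0 < k * sin ts ^ 2 * (1 - sin ts ^ 2))
  by (repeat apply Rmult_lt_0_compat; lra).
nra.
Qed.

Lemma Pfun_pos (th ts : R) : 0 < th <= ts -> ts < PI / 2 ->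
  0 < Pfun Lambda a th ts.
Proof.
intros h1 h2; apply Rmult_lt_0_compat; [exact ha |].
now apply sqrt_lt_R0, Pfun_radicand_pos.
Qed.

Lemma continuous_inv_Pfun (th ts : R) : 0 < th <= ts -> ts < PI / 2 ->
  continuous (fun th' => / Pfun Lambda a th' ts) th.
Proof.
intros h1 h2; apply (@ex_derive_continuous R_AbsRing R_NormedModule).
pose proof (Pfun_radicand_pos th ts h1 h2) as h3.
pose proof (Pfun_pos th ts h1 h2) as h4.
unfold Pfun, Delta_theta in *; auto_derive.
repeat split; [exact h3 |]; apply Rgt_not_eq, h4.
Qed.

(** Once its orientation is reversed, the [theta]-integral equals the [r]-integral, since [F]
    vanishes. *)
Lemma RInt_inv_Pfun_le (r theta ts : R) : rm <= r <= rp ->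
  0 < theta <= ts -> ts < PI / 2 -> Ffun Lambda M a e rp r theta ts = 0 ->
  a * RInt (fun th' => / Pfun Lambda a th' ts) theta ts
    <= atan (rp / a) - atan (rm / a).
Proof.
intros hr h1 h2 hF.
assert (I : ex_RInt (fun th' => / Pfun Lambda a th' ts) theta ts).
{ apply (@ex_RInt_continuous R_CompleteNormedModule).
  rewrite Rmin_left, Rmax_right by lra.
  intros x hx; apply continuous_inv_Pfun; lra. }
pose proof (opp_RInt_swap _ _ _ I) as hs; change opp with Ropp in hs.
unfold Ffun in hF; rewrite <- hs in hF.
replace (RInt (fun th' => / Pfun Lambda a th' ts) theta ts)
  with (RInt (fun r' => / Qfun Lambda M a e r' ts) r rp) by lra.
now apply RInt_inv_Qfun_le.
Qed.

(** * Bound on the ratio of cosines *)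

Lemma cos_ratio_le (r theta ts : R) : rm <= r <= rp ->
  0 < theta <= ts -> ts < PI / 2 -> Ffun Lambda M a e rp r theta ts = 0 ->
  cos theta / cos ts <= exp (sqrt (1 + k) * PI).
Proof.
intros hr h1 h2 hF; pose proof k_pos as hk.
pose proof (RInt_inv_Pfun_le r theta ts hr h1 h2 hF) as hI.
assert (hw : 0 < sqrt (1 + k)) by (apply sqrt_lt_R0; lra).
set (w := sqrt (1 + k)) in *.
assert (hc : forall x, theta <= x <= ts -> 0 < cos x)
  by (intros x hx; apply cos_gt_0; lra).
assert (h : / (a * w) * - ln (cos ts) - / (a * w) * - ln (cos theta)
            <= RInt (fun th' => / Pfun Lambda a th' ts) theta ts).
(* The factor [sin x <= 1] makes the lower bound explicitly integrable. *)
{ apply (RInt_ge_increment _ (fun x => / (a * w) * (sin x / cos x))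
           (fun x => / (a * w) * - ln (cos x))); [lra | | | |].
  - intros x hx; specialize (hc x hx); auto_derive; [lra |]; field; lra.
  - intros x hx; specialize (hc x hx).
    apply (@ex_derive_continuous R_AbsRing R_NormedModule); auto_derive; lra.
  - intros x hx; apply continuous_inv_Pfun; lra.
  - intros x hx; specialize (hc x hx).
    apply Rle_trans with (/ (a * w * cos x)).
    + replace (/ (a * w * cos x)) with (/ (a * w) * (1 / cos x))
        by (field; lra).
      apply Rmult_le_compat_l; [left; apply Rinv_0_lt_compat; nra |].
      apply Rmult_le_compat_r; [left; now apply Rinv_0_lt_compat |].
      apply SIN_bound.
    + apply Rinv_le_contravar; [apply Pfun_pos; lra |].
      unfold Pfun; rewrite Rmult_assoc.
      apply Rmult_le_compat_l; [lra |].
      rewrite <- (sqrt_pow2 (cos x)) by lra.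
      unfold w; rewrite <- sqrt_mult by nra.
      apply sqrt_le_1_alt; rewrite Pfun_radicand_sin.
      pose proof (SIN_bound ts).
      assert (sin ts ^ 2 <= 1) by nra.
      assert (E : cos x ^ 2 = 1 - sin x ^ 2)
        by (rewrite <- !Rsqr_pow2, cos2; ring).
      (* [(1 + k) * cos x ^ 2] exceeds the radicand by [(1 - sin ts ^ 2) * (1 + k * cos x ^ 2)]. *)
      assert (0 <= k * (cos x ^ 2 * (1 - sin ts ^ 2)))
        by (repeat apply Rmult_le_pos; try apply pow2_ge_0; lra).
      rewrite E in *; nra. }
rewrite <- Rmult_minus_distr_l in h; apply (Rmult_le_compat_l (a * w)) in h;
  [| nra].
rewrite <- Rmult_assoc, Rinv_r, Rmult_1_l in h by nra.
pose proof (hc theta ltac:(lra)); pose proof (hc ts ltac:(lra)).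
rewrite <- (exp_ln (cos theta / cos ts)) by (apply Rdiv_lt_0_compat; lra).
rewrite ln_div by lra.
(* The constant [PI] bounds the difference of two arctangents. *)
assert (hle : ln (cos theta) - ln (cos ts) <= w * PI).
{ pose proof (atan_bound (rp / a)); pose proof (atan_bound (rm / a)).
  apply Rle_trans with
    (w * (a * RInt (fun th' => / Pfun Lambda a th' ts) theta ts)); [lra |].
  apply Rmult_le_compat_l; lra. }
destruct hle as [hlt | ->]; [left; now apply exp_increasing | lra].
Qed.

(** * Bound on the ratio of sines *)

Lemma sin_ratio_le (r theta ts : R) : rm <= r <= rp ->
  0 < theta <= ts -> ts < PI / 2 -> Ffun Lambda M a e rp r theta ts = 0 ->
  sin ts / sin theta <= a / (rm * sqrt k).
Proof.
intros hr h1 h2 hF; pose proof k_pos as hk.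
pose proof (RInt_inv_Pfun_le r theta ts hr h1 h2 hF) as hI.
assert (hsk : 0 < sqrt k) by (apply sqrt_lt_R0; lra).
assert (hts : 0 < sin ts) by (apply sin_gt_0; lra).
assert (hth : 0 < sin theta) by (apply sin_gt_0; lra).
assert (hrad : forall x, theta <= x <= ts ->
  sin ts ^ 2 * k <= sin ts ^ 2 * (1 + k) - sin x ^ 2).
{ intros x hx; destruct (sin_sq_le x ts); lra. }
assert (hk2 : 0 < sin ts ^ 2 * k) by (apply Rmult_lt_0_compat; nra).
(* [atan (y x)] is the arcsine of [sin x / (sin ts * sqrt (1 + k))]. *)
pose (y := fun x => sin x / sqrt (sin ts ^ 2 * (1 + k) - sin x ^ 2)).
assert (h : / a * atan (y ts) - / a * atan (y theta)
            <= RInt (fun th' => / Pfun Lambda a th' ts) theta ts).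
{ apply (RInt_ge_increment _
    (fun x => cos x / (a * sqrt (sin ts ^ 2 * (1 + k) - sin x ^ 2)))
    (fun x => / a * atan (y x))); [lra | | | |].
  - intros x hx; specialize (hrad x hx).
    assert (hq : 0 < sqrt (sin ts ^ 2 * (1 + k) - sin x ^ 2))
      by (apply sqrt_lt_R0; lra).
    unfold y; auto_derive.
    { repeat split; [lra |]; apply Rgt_not_eq, hq. }
    change (sin ts * (sin ts * 1) * (1 + k) + - (sin x * (sin x * 1)))
      with (sin ts ^ 2 * (1 + k) - sin x ^ 2).
    set (q := sqrt _) in *.
    field; split; [lra |]; split; [lra | nra].
  - intros x hx; specialize (hrad x hx).
    apply (@ex_derive_continuous R_AbsRing R_NormedModule); auto_derive.
    repeat split; [lra |].
    apply Rgt_not_eq, Rmult_lt_0_compat; [lra |]; apply sqrt_lt_R0; lra.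
  - intros x hx; apply continuous_inv_Pfun; lra.
  - intros x hx; specialize (hrad x hx).
    apply Rle_trans with (/ (a * sqrt (sin ts ^ 2 * (1 + k) - sin x ^ 2))).
    + rewrite <- (Rmult_1_l (/ _)); apply Rmult_le_compat_r;
        [| apply COS_bound].
      left; apply Rinv_0_lt_compat, Rmult_lt_0_compat; [lra |].
      apply sqrt_lt_R0; lra.
    + apply Rinv_le_contravar; [apply Pfun_pos; lra |].
      apply Rmult_le_compat_l; [lra |].
      apply sqrt_le_1_alt; rewrite Pfun_radicand_sin.
      pose proof (pow2_ge_0 (sin x)); nra. }
rewrite <- Rmult_minus_distr_l in h; apply (Rmult_le_compat_l a) in h; [| lra].
rewrite <- Rmult_assoc, Rinv_r, Rmult_1_l in h by lra.
assert (hyts : y ts = / sqrt k).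
{ unfold y.
  replace (sin ts ^ 2 * (1 + k) - sin ts ^ 2) with (sin ts ^ 2 * k) by ring.
  rewrite sqrt_mult, sqrt_pow2 by nra; field; lra. }
destruct hsub as [_ [_ [hrm [hrmp _]]]].
assert (hrp : atan (rp / a) <= atan (y ts)).
{ apply atan_le; rewrite hyts.
  apply Rmult_le_reg_r with (a * sqrt k); [nra |].
  replace (/ sqrt k * (a * sqrt k)) with a by (field; lra).
  replace (rp / a * (a * sqrt k)) with (rp * sqrt k) by (field; lra).
  apply Rsqr_incr_0_var; [| lra].
  rewrite !Rsqr_pow2, Rpow_mult_distr, pow2_sqrt by lra.
  pose proof rp_lt_cosmological_radius; unfold k.
  pose proof (pow2_ge_0 a); nra. }
assert (hy : rm / a <= y theta) by (apply atan_le_inv; lra).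
(* This lower bound on the denominator of [y theta] turns [hy] into a bound on [sin ts]. *)
assert (hle : sqrt (sin ts ^ 2 * k)
              <= sqrt (sin ts ^ 2 * (1 + k) - sin theta ^ 2))
  by (apply sqrt_le_1_alt, hrad; lra).
rewrite sqrt_mult, sqrt_pow2 in hle by nra.
unfold y in hy; set (q := sqrt (_ - _)) in *.
assert (hq : 0 < q) by nra.
apply (Rmult_le_compat_r (a * q)) in hy; [| nra].
replace (rm / a * (a * q)) with (rm * q) in hy by (field; lra).
replace (sin theta / q * (a * q)) with (a * sin theta) in hy by (field; lra).
apply Rmult_le_reg_r with (sin theta * (rm * sqrt k));
  [repeat apply Rmult_lt_0_compat; assumption |].
replace (sin ts / sin theta * (sin theta * (rm * sqrt k)))
  with (rm * (sin ts * sqrt k)) by (field; lra).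
replace (a / (rm * sqrt k) * (sin theta * (rm * sqrt k)))
  with (a * sin theta) by (field; lra).
apply Rle_trans with (rm * q); [| lra].
apply Rmult_le_compat_l; lra.
Qed.

End BlackHole.

(** * Continuity at the two angles and the final constant *)

(** Closeness is asked of the angle only: at 0 and [PI / 2] the value of [thstar] is the same for
    all [r], and the estimates are uniform in [r]. *)
Lemma theta_star_continuous_at_of_ball (rm rp : R) (thstar : R -> R -> R)
  (r theta : R) :
  (forall eps : posreal, exists delta : posreal, forall r' theta',
     rm <= r' <= rp -> 0 <= theta' <= PI -> Rabs (theta' - theta) < delta ->
     Rabs (thstar r' theta' - thstar r theta) < eps) ->
  theta_star_continuous_at rm rp thstar r theta.
Proof.
intros h; apply filterlim_locally; intros eps.
destruct (h eps) as [delta hd]; exists delta.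
intros [r' theta'] [_ hb] [h1 h2]; now apply hd.
Qed.

Theorem lemma2p5 (Lambda M a e rn rm rp rc : R)
  (hLambda : 0 < Lambda) (hM : 0 < M) (ha : 0 < a)
  (hsub : subextremal Lambda M a e rn rm rp rc) :
  exists C : R, 0 < C /\
    forall thstar : R -> R -> R,
      is_theta_star Lambda M a e rm rp thstar ->
      (forall r : R, rm <= r <= rp ->
         theta_star_continuous_at rm rp thstar r 0 /\
         theta_star_continuous_at rm rp thstar r (PI / 2)) /\
      (forall r theta : R, rm <= r <= rp -> 0 < theta < PI / 2 ->
         sin (thstar r theta) / sin theta
         + cos theta / cos (thstar r theta) <= C).
Proof.
pose (A := a / (rm * sqrt (Lambda / 3 * a ^ 2))).
pose (B := exp (sqrt (1 + Lambda / 3 * a ^ 2) * PI)).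
assert (hA : 0 < A).
{ destruct hsub as [_ [_ [hrm _]]]; apply Rdiv_lt_0_compat; [exact ha |].
  apply Rmult_lt_0_compat; [exact hrm |]; apply sqrt_lt_R0.
  now apply k_pos. }
exists (A + B); split; [apply Rplus_lt_0_compat; [exact hA | apply exp_pos] |].
intros thstar hts; pose proof PI_RGT_0 as hPI.
assert (hbd : forall r theta, rm <= r <= rp -> 0 < theta < PI / 2 ->
  theta <= thstar r theta < PI / 2 /\
  sin (thstar r theta) / sin theta <= A /\
  cos theta / cos (thstar r theta) <= B).
{ intros r theta hr hth.
  destruct (proj1 (hts r hr) theta hth) as [[h1 h2] _].
  split; [exact h1 |]; split.
  - apply (sin_ratio_le Lambda M a e rn rm rp rc hLambda ha hsub r); auto; lra.
  - apply (cos_ratio_le Lambda M a e rn rm rp rc hLambda ha hsub r); auto; lra. }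
split.
2: { intros r theta hr hth; destruct (hbd r theta hr hth) as [_ [h1 h2]]; lra. }
intros r hr; split; apply theta_star_continuous_at_of_ball; intros eps.
- destruct (hts r hr) as [_ [h0 _]]; rewrite h0.
  (* The cap [PI / 4] keeps [d] where sine is positive and increasing. *)
  pose (d := Rmin eps (PI / 4)).
  assert (hd : 0 < d) by (apply Rmin_pos; [apply cond_pos | lra]).
  assert (hd1 : d <= eps) by apply Rmin_l.
  assert (hd2 : d <= PI / 4) by apply Rmin_r.
  assert (hs : 0 < sin d / A)
    by (apply Rdiv_lt_0_compat; [apply sin_gt_0; lra | exact hA]).
  (* With this radius, [sin (thstar r' th) <= A * sin th < A * th < sin d] for [th > 0]. *)
  exists (mkposreal _ (Rmin_pos _ _ hs (ltac:(lra) : 0 < PI / 2))); simpl.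
  intros r' th hr' hth hlt; rewrite Rminus_0_r in *.
  rewrite Rabs_pos_eq in hlt by lra.
  assert (hl1 : th < sin d / A) by (eapply Rlt_le_trans; [exact hlt | apply Rmin_l]).
  assert (hl2 : th < PI / 2) by (eapply Rlt_le_trans; [exact hlt | apply Rmin_r]).
  destruct (proj1 hth) as [hpos | <-].
  2: { destruct (hts r' hr') as [_ [-> _]]; rewrite Rabs_R0; apply cond_pos. }
  destruct (hbd r' th hr' (conj hpos hl2)) as [h1 [h2 _]].
  rewrite Rabs_pos_eq by lra.
  apply Rlt_le_trans with d; [| exact hd1].
  assert (hsth : 0 < sin th) by (apply sin_gt_0; lra).
  apply sin_increasing_0; try lra.
  apply Rle_lt_trans with (A * sin th).
  + apply (Rmult_le_compat_r (sin th)) in h2; [| lra].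
    unfold Rdiv in h2; rewrite Rmult_assoc, Rinv_l in h2; lra.
  + apply Rle_lt_trans with (A * th).
    * apply Rmult_le_compat_l; [lra |]; left; now apply sin_lt_x.
    * replace (sin d) with (A * (sin d / A)) by (field; lra).
      now apply Rmult_lt_compat_l.
- destruct (hts r hr) as [_ [_ [h0 _]]]; rewrite h0.
  (* The cap [PI / 2] keeps [th] strictly between 0 and [PI]. Below [PI / 2], [thstar] is squeezed
     between [th] and [PI / 2]; above, reflection reduces to that case. *)
  exists (mkposreal _ (Rmin_pos _ _ (cond_pos eps) (ltac:(lra) : 0 < PI / 2))).
  simpl; intros r' th hr' hth hlt.
  assert (hl1 : Rabs (th - PI / 2) < eps)
    by (eapply Rlt_le_trans; [exact hlt | apply Rmin_l]).
  assert (hl2 : Rabs (th - PI / 2) < PI / 2)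
    by (eapply Rlt_le_trans; [exact hlt | apply Rmin_r]).
  apply Rabs_def2 in hl1; apply Rabs_def2 in hl2.
  destruct (hts r' hr') as [_ [_ [hmid hrefl]]].
  destruct (Rtotal_order th (PI / 2)) as [h | [-> | h]].
  + destruct (hbd r' th hr' ltac:(lra)) as [h1 _]; apply Rabs_def1; lra.
  + rewrite hmid, Rminus_diag, Rabs_R0; apply cond_pos.
  + rewrite hrefl by lra.
    destruct (hbd r' (PI - th) hr' ltac:(lra)) as [h1 _]; apply Rabs_def1; lra.
Qed.
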